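(* Let $K$ be a field, let $\Delta$ be a quasi-forest on $[n]$, and let $C_1,\ldots,C_r$ be the minimal vertex covers of $G_\Delta$. For $j=1,\ldots,r$ let $P_{C_j}=(x_Ft : F\in\Delta,\ F\subseteq C_j)\subset R_\Delta$. Then (i) $[\omega_{R_\Delta}]=\sum_{j=1}^r(n-|C_j|)[P_{C_j}]$ in $\operatorname{Cl}(R_\Delta)$; (ii) the $a$-invariant of $R_\Delta$ is $-(c_\Delta+1)$, where $c_\Delta$ is the face cover number of $\Delta$.
   Context: Let $\Delta$ be a simplicial complex on $[n]=\{1,\dots,n\}$ (a family of subsets of $[n]$ closed under taking subsets and containing every $\{i\}$). For $F\subseteq[n]$ put $x_F=\prod_{i\in F}x_i$ (with $x_\emptyset=1$). The toric ring is $R_\Delta=K[x_Ft : F\in\Delta]\subset K[x_1,\ldots,x_n,t]$, standard graded by letting a monomial $x_1^{a_1}\cdots x_n^{a_n}t^k$ have degree $k$. $G_\Delta$ is the graph (1-skeleton) on $[n]$ whose edges are the two-element faces of $\Delta$. A vertex cover of a graph is a set of vertices meeting every edge; minimal means with respect to inclusion. $\langle F_1,\ldots,F_i\rangle$ denotes the simplicial complex generated by $F_1,\ldots,F_i$. A facet $F$ of a simplicial complex is called a leaf if there exists a facet $G\ne F$ such that $F\cap H\subseteq G$ for every facet $H\neq F$ (if $F$ is the only facet it is also regarded as a leaf). $\Delta$ is a quasi-forest if its facets can be ordered $F_1<\cdots<F_m$ so that $F_i$ is a leaf of $\langle F_1,\ldots,F_i\rangle$ for all $i$ (equivalently, $\Delta$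 is the clique complex of a chordal graph). For a quasi-forest, $R_\Delta$ is a Cohen–Macaulay normal domain, the $P_{C_j}$ are height one prime ideals, and the canonical module $\omega_{R_\Delta}$ is identified with the divisorial ideal of $R_\Delta$ spanned by the monomials whose exponent vectors lie in the relative interior of the cone in $\mathbb{R}^{n+1}$ generated by the exponent vectors of the $x_Ft$, $F\in\Delta$. $\operatorname{Cl}(R_\Delta)$ is the divisor class group. A face cover of $\Delta$ is a collection of faces whose union is $[n]$; $c_\Delta$ is the minimum size of a face cover. The $a$-invariant of $R_\Delta$ is $-\min\{i : (\omega_{R_\Delta})_i\neq0\}$. *)

(* Defs.v *)
From HB Require Import structures.
From mathcomp Require Import all_boot all_order all_algebra.
(* mpoly must be imported before the topology files: the converse order is a
   notation clash. *)
From mathcomp Require Import mpoly.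
From mathcomp Require Import boolp classical_sets reals topology.
(* gives [set0], [cover], ... their meaning on finite sets *)
From mathcomp Require Import finset.

Set Implicit Arguments.
Unset Strict Implicit.
Unset Printing Implicit Defensive.

Import Order.TTheory GRing.Theory Num.Theory.
Import numFieldTopology.Exports.

Local Open Scope ring_scope.

(** * Simplicial complexes and quasi-forests *)

Section Complexes.
Variable n : nat.
Implicit Types (D : {set {set 'I_n}}) (F C : {set 'I_n}) (S : {set {set 'I_n}}).

(* The condition [set0 \in D] follows from the other two unless n = 0, where it
   rules out the empty family. *)
Definition simplicial_complex D : bool :=
  [&& set0 \in D,
      [forall F in D, forall G : {set 'I_n}, (G \subset F) ==> (G \in D)] &
      [forall i : 'I_n, [set i] \in D]].

Definition facets D : {set {set 'I_n}} := [set F | maxset (fun G => G \in D) F].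

Definition complex_gen (s : seq {set 'I_n}) : {set {set 'I_n}} :=
  [set G : {set 'I_n} | has (fun F : {set 'I_n} => G \subset F) s].

Definition leaf D F : bool :=
  (F \in facets D) &&
  ((facets D == [set F]) ||
   [exists G in facets D, (G != F) &&
     [forall H in facets D, (H != F) ==> (F :&: H \subset G)]]).

Definition quasi_forest D : Prop :=
  exists s : seq {set 'I_n},
    [/\ uniq s, s =i facets D &
        forall i, (i < size s)%N ->
          leaf (complex_gen (take i.+1 s)) (nth set0 s i)].

Definition skeleton D : rel 'I_n := fun i j => (i != j) && ([set i; j] \in D).

Definition vertex_cover (e : rel 'I_n) C : bool :=
  [forall i, forall j, e i j ==> (i \in C) || (j \in C)].

Definition min_vertex_cover (e : rel 'I_n) C : bool :=
  minset (vertex_cover e) C.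

Definition face_cover D S : bool := (S \subset D) && (cover S == [set: 'I_n]).

(* D itself is a face cover when D is a simplicial complex. *)
Definition face_cover_number D : nat :=
  #|[arg min_(S < D | face_cover D S) #|S|]|.

End Complexes.

(** * The divisor class group of a domain *)

(* For a domain R with fraction field L, two nonzero fractional ideals define
   the same divisor when they have the same divisorial closure R : (R : I), and
   the product of fractional ideals induces the addition of divisors (Bourbaki,
   Algebre commutative, VII.1).  [Cl R] is the quotient of the commutative
   monoid of divisors by the principal ones, written additively; its elements
   are the divisorial fractional ideals up to multiplication by an element of
   L^*.  It is a group when R is completely integrally closed ([Cl_oppr] below),
   in particular when R is a noetherian normal domain. *)

Section ClassGroup.
Variable R : idomainType.
Local Notation L := {fraction R}.
Local Notation "r %:L" := (@FracField.tofrac R r) (at level 2, format "r %:L").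
Implicit Types I J : set L.

Definition is_fracideal I : Prop :=
  [/\ exists2 x, I x & x != 0,
      forall x y, I x -> I y -> I (x + y),
      forall (r : R) x, I x -> I (r%:L * x) &
      exists2 d : R, d != 0 & forall x, I x -> exists r : R, d%:L * x = r%:L].

Record fracideal := FracIdeal {
  fracideal_set :> set L;
  fracidealP : is_fracideal fracideal_set }.

HB.instance Definition _ := gen_eqMixin fracideal.
HB.instance Definition _ := gen_choiceMixin fracideal.

(* R : I *)
Definition fi_dual I : set L :=
  fun x => forall y, I y -> exists r : R, x * y = r%:L.

Definition div_closure I : set L := fi_dual (fi_dual I).

Definition fi_mul I J : set L :=
  fun x => exists (k : nat) (a b : 'I_k -> L),
    (forall i, I (a i) /\ J (b i)) /\ x = \sum_(i < k) a i * b i.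

Definition fi_one : set L := fun x => exists r : R, x = r%:L.

Lemma fi_one_fracideal : is_fracideal fi_one.
Proof.
split.
- by exists 1; [exists 1; rewrite rmorph1 | rewrite oner_neq0].
- by move=> _ _ [r ->] [s ->]; exists (r + s); rewrite rmorphD.
- by move=> r _ [s ->]; exists (r * s); rewrite rmorphM.
- by exists 1; [rewrite oner_neq0 | move=> _ [r ->]; exists r; rewrite rmorph1 mul1r].
Qed.

Lemma fi_mul_gen I J x y : I x -> J y -> fi_mul I J (x * y).
Proof.
move=> Ix Jy; exists 1%N, (fun=> x), (fun=> y); split=> //.
by rewrite big_ord1.
Qed.

Lemma fi_mul_fracideal I J :
  is_fracideal I -> is_fracideal J -> is_fracideal (fi_mul I J).
Proof.
move=> [[x Ix x0] ID IZ [d d0 Id]] [[y Jy y0] JD JZ [e e0 Je]]; split.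
- by exists (x * y); [exact: fi_mul_gen | rewrite mulf_neq0].
- move=> _ _ [k [a [b [ab ->]]]] [l [a' [b' [ab' ->]]]].
  pose f (c : 'I_k -> L) c' (i : 'I_(k + l)) :=
    match split i with inl j => c j | inr j => c' j end.
  exists (k + l)%N, (f a a'), (f b b'); split.
    by move=> i; rewrite /f; case: splitP => j _.
  rewrite big_split_ord /=; congr (_ + _); apply: eq_bigr => i _; rewrite /f.
    by have /= := unsplitK (inl i : 'I_k + 'I_l)%type => ->.
  by have /= := unsplitK (inr i : 'I_k + 'I_l)%type => ->.
- move=> r _ [k [a [b [ab ->]]]].
  exists k, (fun i => r%:L * a i), b; split.
    by move=> i; have [? ?] := ab i; split=> //; apply: IZ.
  by rewrite mulr_sumr; apply: eq_bigr => i _; rewrite mulrA.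
- exists (d * e); first by rewrite mulf_neq0.
  move=> _ [k [a [b [ab ->]]]].
  have /choice[r rE] : forall i, exists r, (d * e)%:L * (a i * b i) = r%:L.
    move=> i; have [/Id[r rE] /Je[s sE]] := ab i.
    by exists (r * s); rewrite !rmorphM mulrACA rE sE.
  exists (\sum_i r i); rewrite mulr_sumr rmorph_sum.
  by apply: eq_bigr => i _; rewrite rE.
Qed.

Definition fracideal_one := FracIdeal fi_one_fracideal.
Definition fracideal_mul (I J : fracideal) :=
  FracIdeal (fi_mul_fracideal (fracidealP I) (fracidealP J)).

(* equality of the divisors of I and J up to a principal divisor *)
Definition class_equiv (I J : fracideal) : bool :=
  `[< exists2 f : L, f != 0 &
        div_closure I = [set f * x | x in div_closure J]%classic >].

Lemma fi_dual_closure I : fi_dual (div_closure I) = fi_dual I.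
Proof.
apply/seteqP; split=> x Ix y Iy; last by rewrite mulrC; apply: Iy.
by apply: Ix => z Iz; rewrite mulrC; apply: Iz.
Qed.

Lemma fi_dual_scale (f : L) I : f != 0 ->
  fi_dual [set f * x | x in I]%classic = (fun x => fi_dual I (x * f)).
Proof.
move=> f0; apply/seteqP; split=> x Ix y.
  by move=> Iy; rewrite -mulrA; apply: Ix; exists y.
by case=> z Iz <-; rewrite mulrA; apply: Ix.
Qed.

Lemma class_equivP (I J : fracideal) :
  reflect (exists2 f : L, f != 0 & forall x, fi_dual I x <-> fi_dual J (x * f))
          (class_equiv I J).
Proof.
apply: (iffP (asboolP _)) => -[f f0 IJ]; exists f => //.
  by move=> x; rewrite -(fi_dual_closure I) IJ fi_dual_scale // fi_dual_closure.
have {}IJ : fi_dual I = [set f^-1 * x | x in fi_dual J]%classic.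
  apply/seteqP; split=> [x /IJ Jx|_ [x Jx <-]].
    by exists (x * f) => //; rewrite mulrCA mulVf ?mulr1.
  by apply/IJ; rewrite mulrC mulrA mulfV // mul1r.
rewrite /div_closure IJ fi_dual_scale ?invr_eq0 //; apply/seteqP; split.
  by move=> x Jx; exists (x * f^-1) => //; rewrite mulrCA mulfV ?mulr1.
by move=> _ [x Jx <-]; rewrite mulrC mulrA mulVf // mul1r.
Qed.

Lemma class_equiv_refl : reflexive class_equiv.
Proof.
by move=> I; apply/class_equivP; exists 1; rewrite ?oner_neq0 // => x; rewrite mulr1.
Qed.

Lemma class_equiv_sym : ssrbool.symmetric class_equiv.
Proof.
have H (I J : fracideal) : class_equiv I J -> class_equiv J I.
  move=> /class_equivP[f f0 IJ]; apply/class_equivP.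
  exists f^-1; rewrite ?invr_eq0 // => x; split=> [Jx|/IJ].
    by apply/IJ; rewrite mulfVK.
  by rewrite mulfVK.
by move=> I J; apply/idP/idP; apply: H.
Qed.

Lemma class_equiv_trans : transitive class_equiv.
Proof.
move=> J I K /class_equivP[f f0 IJ] /class_equivP[g g0 JK].
apply/class_equivP; exists (f * g); first by rewrite mulf_neq0.
by move=> x; rewrite IJ JK mulrA.
Qed.

Canonical class_equiv_equiv :=
  EquivRel class_equiv class_equiv_refl class_equiv_sym class_equiv_trans.

Definition Cl : Type := {eq_quot class_equiv}%qT.

HB.instance Definition _ : EqQuotient _ class_equiv Cl := EqQuotient.on Cl.
HB.instance Definition _ := Choice.on Cl.

Local Open Scope quotient_scope.

Lemma fi_dual_mul I J x :
  fi_dual (fi_mul I J) x <-> forall y, J y -> fi_dual I (x * y).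
Proof.
split=> [H y Jy z Iz|H _ [k [a [b [ab ->]]]]].
  by rewrite -mulrA [y * z]mulrC; apply: H; apply: fi_mul_gen.
have /choice[r rE] : forall i, exists r, x * (a i * b i) = r%:L.
  by move=> i; have [Ia Jb] := ab i; rewrite [a i * _]mulrC mulrA; apply: H.
by exists (\sum_i r i); rewrite mulr_sumr rmorph_sum; apply: eq_bigr => i _; rewrite rE.
Qed.

Lemma fi_mulC I J : fi_mul I J = fi_mul J I.
Proof.
by apply/seteqP; split=> _ [k [a [b [ab ->]]]]; exists k, b, a; split;
  [move=> i; have [] := ab i | apply: eq_bigr => i _; rewrite mulrC
  |move=> i; have [] := ab i | apply: eq_bigr => i _; rewrite mulrC].
Qed.

Lemma class_equiv_mull (I I' J : fracideal) :
  class_equiv I I' -> class_equiv (fracideal_mul I J) (fracideal_mul I' J).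
Proof.
move=> /class_equivP[f f0 II']; apply/class_equivP; exists f => // x.
rewrite !fi_dual_mul.
by split=> H y /H; rewrite II' [x * f * y]mulrAC.
Qed.

Lemma class_equiv_dual (I J : fracideal) :
  (forall x, fi_dual I x <-> fi_dual J x) -> class_equiv I J.
Proof.
move=> H; apply/class_equivP; exists 1; first by rewrite oner_neq0.
by move=> x; rewrite mulr1.
Qed.

Lemma class_equiv_mulC (I J : fracideal) :
  class_equiv (fracideal_mul I J) (fracideal_mul J I).
Proof. by apply: class_equiv_dual => x /=; rewrite fi_mulC. Qed.

Lemma class_equiv_mulA (I J K : fracideal) :
  class_equiv (fracideal_mul I (fracideal_mul J K))
              (fracideal_mul (fracideal_mul I J) K).
Proof.
apply: class_equiv_dual => x; split=> /fi_dual_mul H; apply/fi_dual_mul => y.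
  move=> Ky; apply/fi_dual_mul => z Jz a Ia.
  have [r rE] := H _ (fi_mul_gen Jz Ky) a Ia.
  by exists r; rewrite -rE [z * y]mulrC mulrA.
move=> JKy a Ia; rewrite mulrAC.
have /fi_dual_mul : forall c, fracideal_set K c -> fi_dual J (x * a * c).
  move=> c Kc b Jb; have /fi_dual_mul/(_ b Jb a Ia)[r rE] := H c Kc.
  by exists r; rewrite -rE -!mulrA; congr (x * _); rewrite mulrC -mulrA.
exact.
Qed.

Lemma class_equiv_mul1 (I : fracideal) :
  class_equiv (fracideal_mul fracideal_one I) I.
Proof.
apply: class_equiv_dual => x; rewrite /= fi_mulC fi_dual_mul; split.
  by move=> /(_ 1); rewrite mulr1; apply; exists 1; rewrite rmorph1.
move=> H _ [r ->] y Iy; have [s sE] := H y Iy.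
by exists (r * s); rewrite tofracM -sE mulrA [r%:L * x]mulrC.
Qed.

Definition Cl_add := lift_op2 Cl fracideal_mul.
Definition Cl_zero : Cl := lift_cst Cl fracideal_one.

Lemma pi_Cl_add : {morph \pi : I J / fracideal_mul I J >-> Cl_add I J}.
Proof.
move=> I J; unlock Cl_add; apply/eqmodP => /=.
have e K : class_equiv K (repr (\pi_Cl K)).
  by apply/eqmodP; rewrite reprK.
apply: class_equiv_trans (class_equiv_mull _ (e I)) _.
apply: class_equiv_trans (class_equiv_mulC _ _) _.
apply: class_equiv_trans (class_equiv_mull _ (e J)) _.
exact: class_equiv_mulC.
Qed.
Canonical pi_Cl_add_morph := PiMorph2 pi_Cl_add.
Canonical pi_Cl_zero_morph := PiConst Cl_zero.

Lemma Cl_addA : associative Cl_add.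
Proof.
elim/quotW=> I; elim/quotW=> J; elim/quotW=> K; rewrite !piE.
by apply/eqmodP; exact: class_equiv_mulA.
Qed.

Lemma Cl_addC : commutative Cl_add.
Proof.
elim/quotW=> I; elim/quotW=> J; rewrite !piE.
by apply/eqmodP; exact: class_equiv_mulC.
Qed.

Lemma Cl_add0 : left_id Cl_zero Cl_add.
Proof.
elim/quotW=> I; rewrite !piE.
by apply/eqmodP; exact: class_equiv_mul1.
Qed.

HB.instance Definition _ := GRing.isNmodule.Build Cl Cl_addA Cl_addC Cl_add0.

(* The class [A] of a nonzero ideal A of R; the value 0 on sets which are not
   nonzero ideals is a convention. *)
Definition Cl_of (A : set R) : Cl :=
  match pselect (is_fracideal [set r%:L | r in A]%classic) with
  | left IA => \pi_Cl (FracIdeal IA)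
  | right _ => 0
  end.

Definition completely_integrally_closed : Prop :=
  forall x : L,
    (exists2 d : R, d != 0 & forall k : nat, exists r : R, d%:L * x ^+ k = r%:L) ->
  exists r : R, x = r%:L.

Lemma fi_dual_fracideal I : is_fracideal I -> is_fracideal (fi_dual I).
Proof.
move=> [[x Ix x0] ID IZ [d d0 Id]]; split.
- by exists d%:L => //; rewrite tofrac_eq0.
- move=> a b Ia Ib y Iy; have [[r rE] [s sE]] := (Ia y Iy, Ib y Iy).
  by exists (r + s); rewrite mulrDl rE sE rmorphD.
- move=> r a Ia y Iy; have [s sE] := Ia y Iy.
  by exists (r * s); rewrite -mulrA sE rmorphM.
- have [e eE] := Id x Ix.
  exists e; first by rewrite -tofrac_eq0 -eE mulf_neq0 // tofrac_eq0.
  move=> a /(_ x Ix)[r rE]; exists (d * r).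
  by rewrite -eE -mulrA [x * a]mulrC rE rmorphM.
Qed.

Lemma Cl_oppr : completely_integrally_closed ->
  forall c : Cl, exists c' : Cl, c + c' = 0.
Proof.
move=> cic; elim/quotW=> I.
exists (\pi_Cl (FracIdeal (fi_dual_fracideal (fracidealP I)))).
rewrite /GRing.add /GRing.zero /= !piE.
apply/eqmodP; apply: class_equiv_dual => x; rewrite fi_dual_mul /=; split.
  move=> H _ [s ->].
  have [[a Ia a0] _ _ _] := fracidealP I.
  have [[b Ib b0] _ _ _] := fi_dual_fracideal (fracidealP I).
  have Hk k : fi_dual I (x ^+ k * b).
    by elim: k => [|k IH]; rewrite ?mul1r // exprS -mulrA; apply: H.
  have [r rE] : exists r, x = r%:L.
    apply: cic; have [d dE] := Ib a Ia.
    exists d; first by rewrite -tofrac_eq0 -dE mulf_neq0.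
    by move=> k; have [r rE] := Hk k a Ia; exists r; rewrite -dE mulrC mulrA.
  by exists (r * s); rewrite rE rmorphM.
move=> /(_ 1)[|r]; first by exists 1; rewrite rmorph1.
rewrite mulr1 => -> y Iy z /Iy[s sE].
by exists (r * s); rewrite -mulrA sE rmorphM.
Qed.

End ClassGroup.

Definition ideal_gen (R : comNzRingType) (S : set R) : set R :=
  fun x => exists (k : nat) (a s : 'I_k -> R),
    (forall i, S (s i)) /\ x = \sum_(i < k) a i * s i.

(** * Cones *)

Section Cones.
Variables (RR : realType) (m : nat).
Local Notation V := 'rV[RR]_m.

Definition cone_gen (S : set V) : set V :=
  fun x => exists (k : nat) (c : 'I_k -> RR) (s : 'I_k -> V),
    (forall i, 0 <= c i /\ S (s i)) /\ x = \sum_(i < k) c i *: s i.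

Definition affine_hull (A : set V) : set V :=
  fun x => exists (k : nat) (c : 'I_k -> RR) (s : 'I_k -> V),
    [/\ forall i, A (s i), \sum_(i < k) c i = 1 & x = \sum_(i < k) c i *: s i].

(* interior of A in the topology induced on its affine hull *)
Definition relative_interior (A : set V) : set V :=
  fun x => affine_hull A x /\ \forall y \near x, affine_hull A y -> A y.

Definition mnm_vec (u : 'X_{1..m}) : V := \row_i (u i)%:R.

End Cones.

(** * Toric rings *)

Section ToricRing.
Variables (K : fieldType) (n : nat).

(* K[x_1, ..., x_n, t] is {mpoly K[n.+1]}: the variable x_i has index
   [xvar i], and t is the last variable. *)
Definition xvar (i : 'I_n) : 'I_n.+1 := widen_ord (leqnSn n) i.
Definition tvar : 'I_n.+1 := ord_max.

(* the exponent vector of x_F t *)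
Definition toric_mnm (F : {set 'I_n}) : 'X_{1..n.+1} :=
  (\sum_(i in F) U_(xvar i) + U_(tvar))%MM.

Variable D : {set {set 'I_n}}.

Definition toric_gens : #|D|.-tuple {mpoly K[n.+1]} :=
  [tuple 'X_[toric_mnm (enum_val i)] | i < #|D|].

(* K[x_F t : F in D], as the set of the polynomial expressions in the x_F t *)
Definition toric_pred : {pred {mpoly K[n.+1]}} :=
  fun p => `[< exists q : {mpoly K[#|D|]}, p = q \mPo toric_gens >].

(* [GRing.inv] of {mpoly K[n.+1]} inverts the nonzero constants and is the
   identity elsewhere, so that subalgebras are closed under it. *)
Fact toric_divring_closed : divring_closed toric_pred.
Proof.
have MP (p q : {mpoly K[n.+1]}) :
    p \in toric_pred -> q \in toric_pred -> p * q \in toric_pred.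
  move=> /asboolP[p' ->] /asboolP[q' ->]; apply/asboolP.
  by exists (p' * q'); rewrite rmorphM.
split.
- by apply/asboolP; exists 1; rewrite rmorph1.
- move=> _ _ /asboolP[p ->] /asboolP[q ->]; apply/asboolP.
  by exists (p - q); rewrite rmorphB.
- move=> p q pT qT; apply: MP => //.
  have [qU|qNU] := boolP (q \is a GRing.unit); last by rewrite invr_out.
  have -> : q^-1 = (q@_0)^-1%:MP by rewrite /GRing.inv /= /mpoly_inv qU.
  by apply/asboolP; exists (q@_0)^-1%:MP; rewrite comp_mpolyC.
Qed.

HB.instance Definition _ :=
  GRing.isDivringClosed.Build {mpoly K[n.+1]} toric_pred toric_divring_closed.

Record toric_ring := ToricRing {
  toric_val : {mpoly K[n.+1]};
  toric_valP : toric_val \in toric_pred }.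

HB.instance Definition _ := [isSub for toric_val].
HB.instance Definition _ := [Choice of toric_ring by <:].
HB.instance Definition _ := [SubChoice_isSubIntegralDomain of toric_ring by <:].

(* the ideal (x_F t : F in D, F \subset C) *)
Definition cover_ideal (C : {set 'I_n}) : set toric_ring :=
  ideal_gen (fun p : toric_ring =>
    exists F : {set 'I_n},
      [/\ F \in D, F \subset C & toric_val p = 'X_[toric_mnm F]]).

Definition toric_cone (RR : realType) : set 'rV[RR]_n.+1 :=
  cone_gen (fun v => exists2 F : {set 'I_n}, F \in D & v = mnm_vec RR (toric_mnm F)).

Arguments toric_cone RR : clear implicits.

(* The K-span of the monomials of the toric ring with exponent vector in the
   relative interior of the cone. *)
Definition canonical_ideal (RR : realType) : set toric_ring :=
  fun p => forall u, u \in msupp (toric_val p) ->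
    relative_interior (toric_cone RR) (mnm_vec RR u).

Arguments canonical_ideal RR : clear implicits.

Definition graded_part (A : set toric_ring) (i : nat) : set toric_ring :=
  fun p => A p /\ forall u, u \in msupp (toric_val p) -> u tvar = i.

Definition nonzero_degree (A : set toric_ring) (i : nat) : Prop :=
  exists2 p, graded_part A i p & p != 0.

(* The default value 0 of the minimum is taken only if the canonical ideal is
   zero. *)
Definition a_invariant (RR : realType) : int :=
  - (xget 0%N (fun i => nonzero_degree (canonical_ideal RR) i /\
       forall j, nonzero_degree (canonical_ideal RR) j -> (i <= j)%N))%:Z.

End ToricRing.

Arguments toric_gens K {n} D.
Arguments toric_pred K {n} D _.
Arguments toric_ring K {n} D.
Arguments cover_ideal K {n} D C.
Arguments canonical_ideal K {n} D RR.
Arguments a_invariant K {n} D RR.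

(* Main.v *)
Require Import Defs.
From mathcomp Require Import all_boot all_order all_algebra.
From mathcomp Require Import mpoly.
From mathcomp Require Import boolp classical_sets reals topology.
From mathcomp Require Import fintype finset ring lra zify.

Set Implicit Arguments.
Unset Strict Implicit.
Unset Printing Implicit Defensive.

Import Order.TTheory GRing.Theory Num.Theory.
Import numFieldTopology.Exports.

Local Open Scope ring_scope.

(** The skeleton of a quasi-forest is a perfect graph.  In the weighted form
    proved here, every nonnegative weight on the vertices is a combination of
    faces whose total is the weight of some stable set
    ([weighted_clique_cover]); the proof is a greedy algorithm along simplicial
    vertices, and it works over the integers as well as over the reals.  Since
    the maximal stable sets are the complements of the minimal vertex covers,
    this describes the cone of the toric ring by the inequalities
    [u (xvar i) >= 0] and [u tvar >= \sum_(i in ~: C) u (xvar i)], where [C] is a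
    minimal vertex cover ([toric_coneP]), and shows that the lattice points of
    the cone are exactly the exponents of the monomials of the ring
    ([toric_predP]).  The monomials of the canonical ideal are those where all
    the inequalities are strict ([relative_interior_mnm]).

    The left-over [u tvar - \sum_(i in ~: C) u (xvar i)] is the valuation of the
    prime [P_C].  Dividing the canonical ideal by the Laurent monomial
    [x_1 ... x_n t] gives the ideal spanned by the monomials of valuation at
    least [n - #|C|] at every [P_C] ([interior_translate]).  This is the
    divisorial closure of the product of the powers [P_C ^ (n - #|C|)]: both
    ideals have the same inverse, which is checked on exponents because an
    element of the inverse has a power of [t] as denominator and because each
    [P_C] contains, for every other minimal vertex cover, a monomial of
    valuation 0 there ([divisor_class_dual], [divisor_class_cover]).  Hence the
    formula for the canonical class.

    Finally a monomial of degree [k + 1] in the canonical ideal is [t] times a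
    product of [k] generators [x_F t], and each variable occurs in it, so that
    the faces [F] cover all the vertices ([face_cover_number_interior]); every
    face cover arises in this way ([face_cover_number_attained]). *)

(** * Weighted clique covers of quasi-forests *)

Section Chordal.
Variables (n : nat) (D : {set {set 'I_n}}).
Implicit Types (F G H S I C : {set 'I_n}) (s : seq {set 'I_n}).

Definition stable I : Prop :=
  forall i j, i \in I -> j \in I -> ~~ skeleton D i j.

Lemma face_in_facet F : F \in D -> exists2 G, G \in facets D & F \subset G.
Proof.
move=> FD; have [G] := maxset_exists FD (P := fun G => G \in D).
by move=> Gmax FG; exists G; rewrite // inE.
Qed.

Lemma facet_face F : F \in facets D -> F \in D.
Proof. by rewrite inE => /maxsetp. Qed.

Lemma facet_maximal F G : F \in facets D -> G \in D -> F \subset G -> F = G.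
Proof. by rewrite inE => /maxsetP[_ Fm] GD FG; rewrite (Fm G). Qed.

(** A subfamily of the facets is an antichain, so it is its own set of facets in
    the complex that it generates; this turns the leaf condition on
    [complex_gen (take i.+1 s)] into a condition on the first facets of [s]. *)
Lemma facets_gen s : {subset s <= facets D} -> facets (complex_gen s) =i s.
Proof.
move=> sD F; apply/idP/idP.
  rewrite inE => /maxsetP[]; rewrite inE => /hasP[G Gs FG] Fm.
  by rewrite -(Fm G) // inE; apply/hasP; exists G.
move=> Fs; rewrite inE; apply/maxsetP; split.
  by rewrite inE; apply/hasP; exists F.
move=> G; rewrite inE => /hasP[H Hs GH] FG; apply/eqP.
rewrite eqEsubset FG andbT.
by rewrite (facet_maximal (sD _ Fs) (facet_face (sD _ Hs)) (subset_trans FG GH)).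
Qed.

(** A vertex of the last leaf [F] outside its branch [G] lies in no earlier facet,
    hence is simplicial.  If [S] has no such vertex then [S :&: F \subset G], the
    facet [F] creates no edge inside [S] that [G] does not already create, and
    [F] can be dropped. *)
Lemma leaf_order_simplicial s :
    {subset s <= facets D} ->
    (forall i, (i < size s)%N ->
       leaf (complex_gen (take i.+1 s)) (nth set0 s i)) ->
  forall k, (k <= size s)%N -> forall S, S != set0 ->
    (forall v, v \in S -> exists2 F, F \in take k s & v \in F) ->
  exists v F, [/\ v \in S, F \in take k s, v \in F &
    forall u G, u \in S -> G \in take k s -> v \in G -> u \in G -> u \in F].
Proof.
move=> sD sleaf; elim=> [|k IHk] ks S S0 Scov.
  by have /set0Pn[v /Scov[F]] := S0; rewrite take0.
set F := nth set0 s k.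
have FE : take k.+1 s = rcons (take k s) F by rewrite (take_nth set0).
have subk : {subset take k s <= take k.+1 s}.
  by move=> G Gs; rewrite FE mem_rcons inE Gs orbT.
have Fk : F \in take k.+1 s by rewrite FE mem_rcons mem_head.
have genE : facets (complex_gen (take k.+1 s)) =i take k.+1 s.
  by apply: facets_gen => G /mem_take /sD.
have := sleaf k ks; rewrite -/F => /andP[_ /orP[/eqP sF|]].
  have eqF G : G \in take k.+1 s -> G = F.
    by rewrite -genE sF inE => /eqP.
  have /set0Pn[v vS] := S0; have [G Gk vG] := Scov v vS.
  exists v, F; split=> //; first by rewrite -(eqF G).
  by move=> u H _ /eqF ->.
move=> /existsP[G /and3P[]]; rewrite genE => Gk1 GF /forallP branch.
have Gk : G \in take k s.
  by move: Gk1; rewrite FE mem_rcons inE (negbTE GF).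
have FG H u : H \in take k.+1 s -> H != F -> u \in F -> u \in H -> u \in G.
  move=> Hk HF uF uH; have := branch H; rewrite genE Hk HF /=.
  by move=> /subsetP; apply; rewrite inE uF.
have [SF|] := boolP (S :&: F \subset G); last first.
  move=> /subsetPn[v]; rewrite inE => /andP[vS vF] vG.
  exists v, F; split=> // u H uS Hk vH uH.
  have [<- //|HF] := eqVneq H F.
  by rewrite (FG H v) in vG.
have {}SF u : u \in S -> u \in F -> u \in G.
  by move=> uS uF; apply: (subsetP SF); rewrite inE uS.
have [v vS|v [F' [vS F'k vF' vsimp]]] := IHk (ltnW ks) S S0.
  have [H Hk vH] := Scov v vS.
  have [HF|HF] := eqVneq H F.
    by exists G => //; apply: SF => //; rewrite -HF.
  by exists H => //; move: Hk; rewrite FE mem_rcons inE (negbTE HF).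
exists v, F'; split=> //; first exact: subk.
move=> u H uS; rewrite FE mem_rcons inE => /predU1P[->|Hk]; last exact: vsimp.
by move=> vF uF; apply: (vsimp u G) => //; apply: SF.
Qed.

Hypotheses (hD : simplicial_complex D) (hqf : quasi_forest D).

Lemma face_sub F G : F \in D -> G \subset F -> G \in D.
Proof.
case/and3P: hD => _ /forall_inP dc _ FD GF.
by have /forallP/(_ G)/implyP := dc _ FD; apply.
Qed.

Lemma face0 : set0 \in D. Proof. by case/and3P: hD. Qed.
Lemma face1 i : [set i] \in D. Proof. by case/and3P: hD => _ _ /forallP. Qed.

(** Every induced subgraph of the skeleton has a vertex whose neighbourhood is
    contained in a face.  The greedy algorithm below runs along such vertices. *)
Lemma simplicial_vertex S : S != set0 ->
  exists v F, [/\ v \in S, v \in F, F \in D, F \subset S &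
    forall u, u \in S -> skeleton D v u -> u \in F].
Proof.
move=> S0; have [s [_ sE sleaf]] := hqf.
have sD : {subset s <= facets D} by move=> F; rewrite sE.
have [v vS|v [F]] := leaf_order_simplicial sD sleaf (leqnn _) S0.
  have [F Fs vF] := face_in_facet (face1 v).
  by exists F; rewrite ?take_size ?sE // -sub1set.
rewrite take_size => -[vS Fs vF vsimp].
exists v, (F :&: S); split=> //; rewrite ?inE ?vF ?vS ?subsetIr //.
  by apply: (face_sub (facet_face (sD _ Fs))); rewrite subsetIl.
move=> u uS /andP[_ vuD]; rewrite inE uS andbT.
have [G Gf] := face_in_facet vuD; rewrite subUset !sub1set => /andP[vG uG].
by apply: (vsimp u G); rewrite ?sE.
Qed.

Lemma stable_face I F : stable I -> F \in D -> (#|F :&: I| <= 1)%N.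
Proof.
move=> Ist FD; rewrite leqNgt; apply/negP => /card_gt1P[i [j [iFI jFI ij]]].
move: iFI jFI; rewrite !inE => /andP[iF iI] /andP[jF jI].
have /negP := Ist i j iI jI; apply; rewrite /skeleton ij /=.
by apply: (face_sub FD); rewrite subUset !sub1set iF.
Qed.

Lemma cover_stable C : vertex_cover (skeleton D) C -> stable (~: C).
Proof.
move=> /forallP Ccov i j; rewrite !inE => /negbTE iC /negbTE jC.
by have /forallP/(_ j) := Ccov i; rewrite iC jC implybF.
Qed.

Lemma stable_cover I : stable I ->
  exists2 C, min_vertex_cover (skeleton D) C & I \subset ~: C.
Proof.
move=> Ist; have [] := minset_exists (P := vertex_cover (skeleton D)) (C := ~: I).
  apply/forallP => i; apply/forallP => j; rewrite !inE; apply/implyP => ij.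
  rewrite -negb_and; apply/negP => /andP[iI jI].
  by rewrite (negbTE (Ist i j iI jI)) in ij.
by move=> C Cmin CI; exists C => //; rewrite -setCS setCK.
Qed.

Section Weights.
Variable T : realDomainType.
Implicit Types (w : 'I_n -> T) (c : {set 'I_n} -> T).

Definition face_weighting c : Prop :=
  (forall F, 0 <= c F) /\ (forall F, F \notin D -> c F = 0).

(** A stable set meets a face in at most one vertex, so no face is counted twice
    in the weight of the stable set. *)
Lemma weak_duality w c I : face_weighting c -> stable I ->
  (forall i : 'I_n, \sum_(F : {set 'I_n} | i \in F) c F = w i) ->
  \sum_(i in I) w i <= \sum_F c F.
Proof.
move=> [c0 cD] Ist cw.
under [leLHS]eq_bigr => i _ do rewrite -cw.
rewrite (exchange_big_dep xpredT) //=; apply: ler_sum => F _.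
rewrite sumr_const; have [FD|/cD ->] := boolP (F \in D); last by rewrite mul0rn.
rewrite -[leRHS]mulr1n; apply: ler_wpMn2l => //.
have := stable_face Ist FD; congr (_ <= _)%N; apply: eq_card => i.
by rewrite !inE andbC.
Qed.

Lemma sum_setI w I : \sum_(i in I) w i = \sum_(i in I :&: [set i | w i != 0]) w i.
Proof.
rewrite (bigID (fun i => w i != 0)) /= [X in _ + X]big1 ?addr0.
  by apply: eq_bigl => i; rewrite !inE.
by move=> i /andP[_ /negPn/eqP].
Qed.

(** Perfection of the skeleton in weighted form: the fractional clique cover
    number and the weighted stability number agree, for real as well as for
    integral weights.  Let [v] be a simplicial vertex of the support of [w] and
    [Q] the face of the support that contains [v] and its neighbours.  Give to
    [Q] the least weight [m] on [Q], subtract, and recurse: at least one vertex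
    leaves the support.  An optimal stable set of the remainder either meets [Q],
    and then in one vertex, whose weight was lowered by [m], or avoids [Q], and
    then can be enlarged by [v]. *)
Lemma weighted_clique_cover w : (forall i, 0 <= w i) ->
  exists c I, [/\ face_weighting c, stable I,
    forall i, \sum_(F : {set 'I_n} | i \in F) c F = w i & \sum_F c F = \sum_(i in I) w i].
Proof.
have [N] := ubnP #|[set i | w i != 0]|; elim: N w => // N IHN w wN w0.
have [S0|S0] := eqVneq [set i | w i != 0] set0.
  have wE i : w i = 0.
    by apply/eqP/negPn/negP => wi; have := in_set0 i; rewrite -S0 inE wi.
  exists (fun=> 0), set0; split=> //; first by move=> i j; rewrite inE.
  - by move=> i; rewrite wE big1.
  - by rewrite !big1.
have [v [Q [vS vQ QD QS vsimp]]] := simplicial_vertex S0.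
have [u uQ' umin] := arg_minP w vQ; have {uQ'}uQ : u \in Q by [].
set m := w u in umin.
have m0 : 0 < m.
  by rewrite lt_neqAle w0 andbT eq_sym; have := subsetP QS _ uQ; rewrite inE.
pose w' i := if i \in Q then w i - m else w i.
have w'0 i : 0 <= w' i by rewrite /w'; case: ifP => // /umin; rewrite subr_ge0.
have w'S i : w' i != 0 -> w i != 0.
  rewrite /w'; case: ifP => // iQ _; have := subsetP QS _ iQ; rewrite inE //.
have w'N : (#|[set i | w' i != 0%R]| < N)%N.
  rewrite -ltnS; apply: leq_trans wN; rewrite ltnS; apply: proper_card.
  apply/properP; split; first by apply/subsetP => i; rewrite !inE => /w'S.
  exists u; first exact: (subsetP QS).
  by rewrite inE /w' uQ subrr eqxx.
have [c' [I0 [fw' I0st cw' cI0]]] := IHN w' w'N w'0.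
have [c'0 c'D] := fw'.
pose c F := c' F + (if F == Q then m else 0).
have fw : face_weighting c.
  split=> F; rewrite /c; first by rewrite addr_ge0 //; case: ifP => // _; exact: ltW.
  move=> FD; rewrite c'D // add0r; case: eqP => // FQ.
  by rewrite FQ QD in FD.
have sumc (P : pred {set 'I_n}) :
    \sum_(F | P F) c F = \sum_(F | P F) c' F + (if P Q then m else 0).
  rewrite big_split /=; congr (_ + _); rewrite -big_mkcondr.
  case: ifP => PQ; last by rewrite big1 // => F /andP[PF /eqP FQ]; rewrite FQ PQ in PF.
  rewrite (big_pred1 Q) // => F /=.
  by case: (F =P Q) => [->|]; rewrite ?andbF ?andbT.
have cw i : \sum_(F : {set 'I_n} | i \in F) c F = w i.
  by rewrite sumc cw' /w'; case: ifP; rewrite ?subrK ?addr0.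
set I := I0 :&: [set i | w' i != 0].
have Ist : stable I.
  by move=> i j; rewrite !inE => /andP[iI _] /andP[jI _]; apply: I0st.
have cI : \sum_F c' F = \sum_(i in I) w' i by rewrite cI0 sum_setI.
have cE : \sum_F c F = \sum_(i in I) w' i + m by rewrite sumc /= cI.
(* If I misses Q then v |: I is still stable, because the neighbours of v in
   the support of w lie in Q; weak duality for w' forces w' v = 0. *)
have [QI|QI] := eqVneq (Q :&: I) set0; last first.
  have /cards1P[x QIx] : #|Q :&: I| == 1%N.
    by rewrite eqn_leq stable_face //= card_gt0.
  have /setP xQI := QIx; have := xQI x; rewrite !inE eqxx => /and3P[xQ xI x0].
  exists c, I; split=> //; rewrite cE.
  rewrite (bigD1 x) /=; last by rewrite !inE xI.
  rewrite [RHS](bigD1 x) /=; last by rewrite !inE xI.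
  rewrite addrAC {1}/w' xQ subrK; congr (_ + _); apply: eq_bigr => i.
  rewrite /w' => /andP[iI ix]; case: ifP => // iQ.
  by have := xQI i; rewrite !inE (negbTE ix) iQ; move: iI; rewrite !inE => ->.
have nQI i : i \in I -> i \notin Q.
  by move=> iI; apply/negP => iQ; have := in_set0 i; rewrite -QI inE iQ iI.
have vI : v \notin I by apply/negP => /nQI; rewrite vQ.
have Jst : stable (v |: I).
  have vi i : i \in I -> ~~ skeleton D v i.
    move=> iI; apply/negP => /vsimp; rewrite (negbTE (nQI i iI)) => abs.
    move: iI; rewrite !inE => /andP[_ /w'S wi].
    by rewrite !inE wi in abs; have := abs isT.
  have sym i j : skeleton D i j = skeleton D j i.
    by rewrite /skeleton eq_sym finset.setUC.
  move=> i j; rewrite !in_setU1 => /predU1P[->|iI] /predU1P[->|jI].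
  - by rewrite /skeleton eqxx.
  - exact: vi.
  - by rewrite sym; apply: vi.
  - exact: Ist.
have w'v : w' v = 0.
  apply/le_anti; rewrite w'0 andbT.
  have := weak_duality fw' Jst cw'; rewrite big_setU1 //= cI.
  by rewrite gerDr.
have wv : w v = m by have /eqP := w'v; rewrite /w' vQ subr_eq0 => /eqP.
exists c, (v |: I); split=> //; rewrite cE big_setU1 //= wv [RHS]addrC.
congr (_ + _).
by apply: eq_bigr => i /nQI; rewrite /w' => /negbTE ->.
Qed.

(** The cone and, over [int], the monoid generated by the exponent vectors of the
    [x_F t] are cut out by the inequalities attached to the minimal vertex
    covers.  The excess of [k] over the weight of an optimal cover is put on the
    empty face. *)
Lemma cone_decomposition w (k : T) : (forall i, 0 <= w i) ->
    (forall C, min_vertex_cover (skeleton D) C -> \sum_(i in ~: C) w i <= k) ->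
  exists c, [/\ face_weighting c, forall i, \sum_(F : {set 'I_n} | i \in F) c F = w i &
    \sum_F c F = k].
Proof.
move=> w0 wk; have [c [I [[c0 cD] Ist cw cI]]] := weighted_clique_cover w0.
have ck : \sum_F c F <= k.
  have [C Cmin IC] := stable_cover Ist; rewrite cI; apply: le_trans (wk _ Cmin).
  by rewrite [leRHS](big_setID I) /= (setIidPr IC) lerDl sumr_ge0.
pose e F := c F + (if F == set0 then k - \sum_F c F else 0).
exists e; split.
- split=> F; rewrite /e.
    by rewrite addr_ge0 //; case: ifP; rewrite // subr_ge0.
  by move=> FD; rewrite cD // add0r ifN //; apply: contraNneq FD => ->; exact: face0.
- move=> i; rewrite -cw; apply: eq_bigr => F iF; rewrite /e ifN ?addr0 //.
  by apply/set0Pn; exists i.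
- by rewrite big_split -big_mkcond big_pred1_eq /= addrC subrK.
Qed.

End Weights.
End Chordal.

(** * Monomials of the toric ring *)

Section ToricMonoid.
Variables (n : nat) (D : {set {set 'I_n}}).
Hypotheses (hD : simplicial_complex D) (hqf : quasi_forest D).
Implicit Types (F C : {set 'I_n}) (u v : 'X_{1..n.+1}).
Local Notation mvc := (min_vertex_cover (skeleton D)).
Local Notation tv := (tvar n).

Lemma var_cases (j : 'I_n.+1) : j = tv \/ exists i, j = xvar i.
Proof.
have [i ->|->] := unliftP ord_max j; last by left.
by right; exists i; apply/val_inj/lift_max.
Qed.

Lemma mnm_xtP u v : (forall i, u (xvar i) = v (xvar i)) -> u tv = v tv -> u = v.
Proof. by move=> ux ut; apply/mnmP => j; have [->|[i ->]] := var_cases j. Qed.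

Lemma xvar_inj : injective (@xvar n).
Proof. by move=> i j /(congr1 val) /= ij; apply: val_inj. Qed.

Lemma tvar_xvar i : (tv == xvar i) = false.
Proof. by apply/eqP => /(congr1 val) /= ni; have := ltn_ord i; rewrite -ni ltnn. Qed.

Lemma toric_mnm_xvar F i : toric_mnm F (xvar i) = (i \in F).
Proof.
rewrite mnmDE mnm_sumE mnm1E tvar_xvar addn0.
under eq_bigr => j _ do rewrite mnm1E (inj_eq xvar_inj).
have [iF|iF] := boolP (i \in F).
  rewrite (bigD1 i) //= eqxx big1 // => j /andP[_ /negbTE ji]; by rewrite ji.
by rewrite big1 // => j jF; case: eqP => // ji; rewrite -ji jF in iF.
Qed.

Lemma toric_mnm_tvar F : toric_mnm F tv = 1%N.
Proof.
rewrite mnmDE mnm_sumE mnm1E eqxx big1 // => j _.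
by rewrite mnm1E eq_sym tvar_xvar.
Qed.

Lemma tvarMn_tvar k : (U_(tv) *+ k)%MM tv = k.
Proof. by rewrite mulmnE mnm1E eqxx mul1n. Qed.

Lemma tvarMn_xvar k i : (U_(tv) *+ k)%MM (xvar i) = 0%N.
Proof. by rewrite mulmnE mnm1E tvar_xvar mul0n. Qed.

Definition off_sum C u : nat := \sum_(i in ~: C) u (xvar i).

Lemma off_sumD C u v : off_sum C (u + v)%MM = (off_sum C u + off_sum C v)%N.
Proof. by rewrite /off_sum -big_split; apply: eq_bigr => i _; rewrite mnmDE. Qed.

Lemma off_sum0 C : off_sum C 0%MM = 0%N.
Proof. by rewrite /off_sum big1 // => i _; rewrite mnm0E. Qed.

Lemma off_sum_toric C F : off_sum C (toric_mnm F) = #|F :\: C|.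
Proof.
rewrite /off_sum -sum1_card; under eq_bigr => i _ do rewrite toric_mnm_xvar.
rewrite (bigID (mem F)) /= [X in (_ + X)%N]big1; last first.
  by move=> i /andP[_ /negbTE ->].
rewrite addn0; under eq_bigr => i /andP[_ ->] do [].
by apply: eq_bigl => i; rewrite !inE.
Qed.

Lemma off_sum_tvarMn C k : off_sum C (U_(tv) *+ k)%MM = 0%N.
Proof. by rewrite /off_sum big1 // => i _; rewrite tvarMn_xvar. Qed.

(** For a minimal vertex cover [C], the function [u tv - off_sum C u] is the
    valuation of the monomials at the height one prime [P_C]: it is 1 on [x_F t]
    if [F \subset C], and 0 if [F] has a vertex outside [C], which is then
    unique.  Thus [divisor_ge d] is the set of exponents of the monomials in
    the divisorial ideal of the divisor [\sum_C d C *: P_C]. *)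
Definition divisor_ge (d : {set 'I_n} -> nat) u : Prop :=
  forall C, mvc C -> (d C + off_sum C u <= u tv)%N.

Definition in_cone u : Prop := divisor_ge (fun=> 0%N) u.

Lemma divisor_geD d d' u v :
  divisor_ge d u -> divisor_ge d' v -> divisor_ge (fun C => d C + d' C)%N (u + v)%MM.
Proof.
by move=> du dv C Cmin; rewrite off_sumD mnmDE addnACA leq_add ?du ?dv.
Qed.

Lemma in_cone0 : in_cone 0%MM.
Proof. by move=> C _; rewrite off_sum0 mnm0E. Qed.

Lemma in_coneD u v : in_cone u -> in_cone v -> in_cone (u + v)%MM.
Proof. by move=> uC vC; apply: (divisor_geD uC vC). Qed.

Lemma divisor_ge_cone d u : divisor_ge d u -> in_cone u.
Proof. by move=> du C Cmin; apply: leq_trans (du C Cmin); rewrite leq_add2r. Qed.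

Lemma mvc_stable C : mvc C -> stable D (~: C).
Proof. by move=> /minsetp /cover_stable. Qed.

Lemma in_cone_toric F : F \in D -> in_cone (toric_mnm F).
Proof.
move=> FD C /mvc_stable Cst; rewrite off_sum_toric toric_mnm_tvar finset.setDE.
exact: (stable_face hD Cst FD).
Qed.

(** Normality of the toric ring: an integral point of the cone is a sum of
    generators, by the duality over [int]. *)
Lemma in_cone_decomposition u : in_cone u ->
  exists c : {set 'I_n} -> nat, [/\ forall F, F \notin D -> c F = 0%N,
    forall i, (\sum_(F : {set 'I_n} | i \in F) c F)%N = u (xvar i) &
    (\sum_F c F)%N = u tv].
Proof.
move=> uC; pose w i : int := (u (xvar i))%:Z.
have [//|C Cmin|c [[c0 cD] cw ck]] :=
    cone_decomposition hD hqf (w := w) (k := (u tv)%:Z).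
  rewrite /w -(big_morph Posz PoszD (erefl _)) lez_nat; exact: uC.
have cE F : c F = (`|c F|%N)%:Z by rewrite gez0_abs.
exists (fun F => `|c F|%N); split.
- by move=> F /cD ->.
- move=> i; apply/eqP; rewrite -eqz_nat (big_morph Posz PoszD (erefl _)) -/(w i) -cw.
  by apply/eqP/eq_bigr => F _; rewrite -cE.
- apply/eqP; rewrite -eqz_nat (big_morph Posz PoszD (erefl _)) -ck.
  by apply/eqP/eq_bigr => F _; rewrite -cE.
Qed.

Lemma toric_combination u (c : {set 'I_n} -> nat) :
    (forall i, (\sum_(F : {set 'I_n} | i \in F) c F)%N = u (xvar i)) ->
    (\sum_F c F)%N = u tv ->
  u = (\sum_F toric_mnm F *+ c F)%MM.
Proof.
move=> cx ct; apply: mnm_xtP => [i|]; rewrite mnm_sumE.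
  rewrite -cx big_mkcond; apply: eq_bigr => F _.
  by rewrite mulmnE toric_mnm_xvar; case: ifP; rewrite ?muln1 ?muln0 ?mul1n ?mul0n.
by rewrite -ct; apply: eq_bigr => F _; rewrite mulmnE toric_mnm_tvar ?mul1n ?muln1.
Qed.

Variable K : fieldType.
Local Notation P := {mpoly K[n.+1]}.

Lemma toricX_gen F : F \in D -> ('X_[toric_mnm F] : P) \in toric_pred K D.
Proof.
move=> FD; apply/asboolP; exists 'X_(enum_rank_in FD F).
by rewrite comp_mpolyXU -tnth_nth tnth_mktuple enum_rankK_in.
Qed.

Lemma toricX u : in_cone u -> ('X_[u] : P) \in toric_pred K D.
Proof.
move=> /in_cone_decomposition[c [cD cx ct]].
rewrite (toric_combination cx ct) (big_morph _ (@mpolyXD _ _) (@mpolyX0 _ _)).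
apply: rpred_prod => F _; rewrite -mpolyXn.
have [FD|/cD ->] := boolP (F \in D); last by rewrite expr0 rpred1.
by rewrite rpredX ?toricX_gen.
Qed.

Lemma toricZ (a : K) (p : P) : p \in toric_pred K D -> a *: p \in toric_pred K D.
Proof.
move=> pT; rewrite -mul_mpolyC rpredM //; apply/asboolP.
by exists a%:MP; rewrite comp_mpolyC.
Qed.

(** The inequalities are additive and hold for the generators; conversely, by
    normality, every monomial with exponent in the cone is a product of
    generators. *)
Lemma toric_predP (p : P) :
  p \in toric_pred K D <-> (forall u, u \in msupp p -> in_cone u).
Proof.
split; last first.
  move=> pC; rewrite [p]mpolyE big_seq; apply: rpred_sum => u up.
  by apply: toricZ; apply: toricX; apply: pC.
case/asboolP => q ->; rewrite comp_mpolyE.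
pose good (r : P) := forall u, u \in msupp r -> in_cone u.
have gM (r s : P) : good r -> good s -> good (r * s).
  move=> rg sg _ /msuppM_le /allpairsP[[u v] /= [ur vs ->]].
  by apply: in_coneD; [apply: rg | apply: sg].
have g1 : good 1.
  by move=> u; rewrite msupp1 inE => /eqP ->; apply: in_cone0.
apply: (big_ind good).
- by move=> u; rewrite msupp0.
- by move=> r s rg sg u /msuppD_le; rewrite mem_cat => /orP[/rg|/sg].
- move=> m _ u /msuppZ_le; move: u; rewrite -/(good _).
  apply: (big_ind good) => // i _; rewrite tnth_mktuple.
  elim: (m i) => [|k IHk]; rewrite ?expr0 // exprS; apply: gM => // u.
  by rewrite msuppX inE => /eqP ->; apply: in_cone_toric; apply: enum_valP.
Qed.

(** Divisibility by a monomial is tested on the support, one monomial at a time. *)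
Lemma toric_divX (h : P) v :
    (forall u, u \in msupp h -> exists2 u', in_cone u' & u = (v + u')%MM) ->
  exists2 r : P, r \in toric_pred K D & h = 'X_[v] * r.
Proof.
move=> hv; exists (\sum_(u <- msupp h) h@_u *: 'X_[u - v]).
  rewrite big_seq; apply: rpred_sum => u /hv[u' u'C ->].
  by apply: toricZ; apply: toricX; rewrite addmC addmK.
rewrite {1}[h]mpolyE mulr_sumr !big_seq; apply: eq_bigr => u /hv[u' _ ->].
by rewrite -scalerAr -mpolyXD [X in (X - v)%MM]addmC addmK.
Qed.

End ToricMonoid.

(** * Lattice points in the interior of the cone *)

Section RelativeInterior.
Variables (RR : realType) (n : nat) (D : {set {set 'I_n}}).
Hypotheses (hD : simplicial_complex D) (hqf : quasi_forest D).
Implicit Types (F C : {set 'I_n}) (u : 'X_{1..n.+1}) (v : 'rV[RR]_n.+1).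
Local Notation mvc := (min_vertex_cover (skeleton D)).
Local Notation tv := (tvar n).

(** The exponent vector of [x_1 ... x_n t^(n+1)],
    a lattice point in the interior of the cone. *)
Definition center : 'X_{1..n.+1} := (toric_mnm [set: 'I_n] + U_(tv) *+ n)%MM.

Lemma center_xvar i : center (xvar i) = 1%N.
Proof. by rewrite mnmDE toric_mnm_xvar tvarMn_xvar inE. Qed.

Lemma center_tvar : center tv = n.+1.
Proof. by rewrite mnmDE toric_mnm_tvar tvarMn_tvar add1n. Qed.

Lemma off_sum_center C : off_sum C center = #|~: C|.
Proof. by rewrite /off_sum -sum1_card; apply: eq_bigr => i _; rewrite center_xvar. Qed.

Definition interior_mnm u : Prop :=
  (forall i, 0 < u (xvar i))%N /\ divisor_ge D (fun=> 1%N) u.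

Lemma interior_center : interior_mnm center.
Proof.
split=> [i|C _]; first by rewrite center_xvar.
by rewrite off_sum_center center_tvar add1n ltnS -[leqRHS]card_ord max_card.
Qed.

(** Real counterpart of the decomposition of lattice points: the duality over [RR]
    writes every solution of the inequalities as a combination of generators. *)
Lemma toric_coneP v : toric_cone D v <->
  (forall i, 0 <= v 0 (xvar i)) /\
  (forall C, mvc C -> \sum_(i in ~: C) v 0 (xvar i) <= v 0 tv).
Proof.
split=> [[k [c [s [cs ->]]]]|[v0 vC]].
  have sE j : exists2 F, F \in D & s j = mnm_vec RR (toric_mnm F) by case: (cs j).
  split=> [i|C Cmin].
    rewrite summxE sumr_ge0 // => j _; rewrite mxE mulr_ge0 ?(cs j).1 //.
    by have [F _ ->] := sE j; rewrite mxE ler0n.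
  under eq_bigr => i _ do rewrite summxE.
  rewrite exchange_big summxE; apply: ler_sum => j _ /=.
  under eq_bigr => i _ do rewrite mxE.
  rewrite -mulr_sumr mxE ler_wpM2l ?(cs j).1 //.
  have [F FD ->] := sE j; under eq_bigr => i _ do rewrite mxE.
  by rewrite mxE -natr_sum ler_nat; apply: (in_cone_toric hD FD Cmin).
have [c [[c0 cD] cx ct]] := cone_decomposition hD hqf v0 vC.
exists #|D|, (c \o enum_val), (fun j => mnm_vec RR (toric_mnm (enum_val j))).
split=> [j|].
  by split; [apply: c0 | exists (enum_val j) => //; apply: enum_valP].
rewrite -(big_enum_val (fun F => c F *: mnm_vec RR (toric_mnm F))) /=.
have sumE (j : 'I_n.+1) : (\sum_(F in D) c F *: mnm_vec RR (toric_mnm F)) 0 j =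
    \sum_F c F * (toric_mnm F j)%:R.
  rewrite summxE [RHS](bigID (mem D)) /= [X in _ + X]big1 ?addr0.
    by apply: eq_bigr => F _; rewrite !mxE.
  by move=> F /cD ->; rewrite mul0r.
apply/rowP => j; rewrite sumE; have [->|[i ->]] := var_cases j.
  by rewrite -ct; apply: eq_bigr => F _; rewrite toric_mnm_tvar mulr1.
rewrite -cx big_mkcond; apply: eq_bigr => F _.
by rewrite toric_mnm_xvar; case: ifP; rewrite ?mulr1 ?mulr0.
Qed.

Lemma mnm_vec_cone u : in_cone D u -> toric_cone D (mnm_vec RR u).
Proof.
move=> uC; apply/toric_coneP; split=> [i|C Cmin]; first by rewrite mxE ler0n.
under eq_bigr => i _ do rewrite mxE.
by rewrite mxE -natr_sum ler_nat; apply: (uC C Cmin).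
Qed.

(** At a lattice point every strict inequality holds with a margin of 1, which
    leaves room for a ball of radius [1 / (n + 1)].  Conversely, from a point [x]
    of the relative interior one can move a little beyond [x] away from [center],
    along a line in the affine hull, without leaving the cone; an inequality
    that is strict at [center] is therefore strict at [x]. *)
Lemma relative_interior_mnm u :
  relative_interior (toric_cone D (RR:=RR)) (mnm_vec RR u) <-> interior_mnm u.
Proof.
set x := mnm_vec RR u; split; last first.
  move=> [u0 uC]; split.
    exists 1%N, (fun=> 1), (fun=> x); rewrite !big_ord1 scale1r; split=> // _.
    by apply: mnm_vec_cone; apply: divisor_ge_cone uC.
  apply/nbhs_ballP; exists (n.+1%:R^-1); first by rewrite /= invr_gt0 ltr0n.
  set e := _^-1 => y [e0 /(_ 0) xy] _.
  have {}xy j : `|(u j)%:R - y 0 j| < e by have := xy j; rewrite mxE.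
  have en : e * n%:R + e = 1.
    by rewrite -[X in _ + X]mulr1 -mulrDr natr1 /e mulVf // pnatr_eq0.
  apply/toric_coneP; split=> [i|C Cmin].
    have := xy (xvar i); rewrite ltr_norml => /andP[_ H].
    have : (1 : RR) <= (u (xvar i))%:R by rewrite ler1n.
    have : 0 <= e * n%:R by rewrite mulr_ge0 ?ler0n // ltW.
    lra.
  have : \sum_(i in ~: C) y 0 (xvar i) <= \sum_(i in ~: C) ((u (xvar i))%:R + e).
    apply: ler_sum => i _; have := xy (xvar i); rewrite ltr_norml => /andP[H _].
    lra.
  rewrite big_split -natr_sum sumr_const -[e *+ _]mulr_natr /=.
  have : e * (#|~: C|)%:R <= e * n%:R.
    by rewrite ler_wpM2l ?(ltW e0) // ler_nat -[leqRHS]card_ord max_card.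
  have := xy tv; rewrite ltr_norml => /andP[_ H].
  have := uC C Cmin; rewrite -(ler_nat RR) natrD /off_sum.
  lra.
move=> [hull nbx].
have xC : toric_cone D x by apply: (nbhs_singleton nbx).
have zC := mnm_vec_cone (divisor_ge_cone interior_center.2).
set z := mnm_vec RR center in zC.
have /nbhs_ballP[e /= e0 xe] := nbx.
pose M := \sum_j `|x 0 j - z 0 j|.
have M0 : 0 <= M by rewrite sumr_ge0.
pose d := e / (1 + M).
have d0 : 0 < d by rewrite divr_gt0 // ltr_pwDl.
have dM : d * M < e.
  by rewrite mulrAC ltr_pdivrMr ?ltr_pwDl // ltr_pM2l // ltrDr ltr01.
(* d is chosen so that x + d (x - z) lies in the ball of radius e at x *)
pose y := (1 + d) *: x + (- d) *: z.
have /toric_coneP[y0 yC] : toric_cone D y.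
  apply: xe.
    split=> // i j; rewrite ord1; apply: le_lt_trans dM.
    have -> : x 0 j - y 0 j = - (d * (x 0 j - z 0 j)).
      by rewrite !mxE; ring.
    rewrite normrN normrM (gtr0_norm d0) ler_wpM2l ?(ltW d0) //.
    by rewrite /M (bigD1 j) //= lerDl sumr_ge0.
  exists 2%N, (fun i => if val i == 0%N then 1 + d else - d).
  exists (fun i => if val i == 0%N then x else z); split.
  - by move=> i; case: ifP.
  - by rewrite big_ord_recl big_ord1 /= addrK.
  - by rewrite big_ord_recl big_ord1.
have yE j : y 0 j = (1 + d) * (u j)%:R - d * (center j)%:R.
  by rewrite !mxE mulNr.
split=> [i|C Cmin].
  rewrite lt0n; apply/eqP => ui; have := y0 i.
  by rewrite yE ui center_xvar mulr0 mulr1 sub0r oppr_ge0 leNgt d0.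
have := yC C Cmin; rewrite add1n ltnNge; apply: contraTN.
under eq_bigr => i _ do rewrite yE.
rewrite sumrB -!mulr_sumr -!natr_sum -/(off_sum _ _) -/(off_sum _ _).
rewrite off_sum_center yE center_tvar -ltNge => ut.
have : (u tv)%:R <= (off_sum C u)%:R :> RR by rewrite ler_nat.
have : (#|~: C|)%:R <= n%:R :> RR by rewrite ler_nat -[leqRHS]card_ord max_card.
rewrite -natr1; nra.
Qed.

End RelativeInterior.

(** * Divisor classes given by monomials *)

Section IdealClass.
Variable R : idomainType.
Local Notation L := {fraction R}.
Local Notation "r %:L" := (@FracField.tofrac R r) (at level 2, format "r %:L").
Local Open Scope quotient_scope.

(** The class of an ideal [A] depends only on [R : A], and [R : A] is determined by
    any set of generators of [A]. *)
Lemma Cl_of_ideal_gen (S : set R) (s0 : R) : S s0 -> s0 != 0 ->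
  exists I : fracideal R, Cl_of (ideal_gen S) = \pi_(Cl R) I /\
    forall x, fi_dual I x <-> forall s, S s -> fi_one (x * s%:L).
Proof.
move=> Ss0 s00.
have genS s : S s -> ideal_gen S s.
  by move=> Ss; exists 1%N, (fun=> 1), (fun=> s); rewrite big_ord1 mul1r.
have IA : is_fracideal [set r%:L | r in ideal_gen S]%classic.
  split.
  - by exists s0%:L; [exists s0 => //; apply: genS | rewrite tofrac_eq0].
  - move=> _ _ [_ [k [a [s [Ss ->]]]] <-] [_ [l [b [t [St ->]]]] <-].
    rewrite -rmorphD; exists (\sum_(i < k) a i * s i + \sum_(i < l) b i * t i) => //.
    pose f (c : 'I_k -> R) c' (i : 'I_(k + l)) :=
      match split i with inl j => c j | inr j => c' j end.
    exists (k + l)%N, (f a b), (f s t); split.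
      by move=> i; rewrite /f; case: splitP => j _.
    rewrite big_split_ord /=; congr (_ + _); apply: eq_bigr => i _; rewrite /f.
      by have /= := unsplitK (inl i : 'I_k + 'I_l)%type => ->.
    by have /= := unsplitK (inr i : 'I_k + 'I_l)%type => ->.
  - move=> r _ [_ [k [a [s [Ss ->]]]] <-]; rewrite -rmorphM.
    exists (r * \sum_(i < k) a i * s i) => //.
    exists k, (fun i => r * a i), s; split=> //.
    by rewrite mulr_sumr; apply: eq_bigr => i _; rewrite mulrA.
  - exists 1; first exact: oner_neq0.
    by move=> _ [r _ <-]; exists r; rewrite rmorph1 mul1r.
exists (FracIdeal IA); split.
  rewrite /Cl_of; case: pselect => [IA'|/(_ IA) //].
  by congr (\pi_(Cl R) (FracIdeal _)); apply: Prop_irrelevance.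
move=> x; split=> [Ix s Ss|H _ [_ [k [a [s [Ss ->]]]] <-]].
  by apply: Ix; exists s => //; apply: genS.
have /choice[r rE] : forall i, fi_one (x * (s i)%:L) by move=> i; apply: H.
exists (\sum_i a i * r i); rewrite !rmorph_sum mulr_sumr; apply: eq_bigr => i _.
by rewrite /= !tofracM -rE mulrCA.
Qed.

End IdealClass.

Section ToricClass.
Variables (n : nat) (D : {set {set 'I_n}}).
Hypotheses (hD : simplicial_complex D) (hqf : quasi_forest D).
Variable K : fieldType.
Implicit Types (F C : {set 'I_n}) (u v m b : 'X_{1..n.+1}) (d : {set 'I_n} -> nat).
Local Notation mvc := (min_vertex_cover (skeleton D)).
Local Notation tv := (tvar n).
Local Notation P := {mpoly K[n.+1]}.
Local Notation R := (toric_ring K D).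
Local Notation L := {fraction R}.
Local Notation "r %:L" := (@FracField.tofrac R r) (at level 2, format "r %:L").
Local Open Scope quotient_scope.

(** The default value 0 is taken when [u] is not in the cone. *)
Definition monom u : R := insubd (0 : R) ('X_[u] : P).

Lemma val_monom u : in_cone D u -> toric_val (monom u) = 'X_[u].
Proof. by move=> uC; apply: (insubdK (0 : R)); apply: toricX. Qed.

Lemma monom_eq u (p : R) : in_cone D u -> toric_val p = 'X_[u] -> p = monom u.
Proof. by move=> uC pu; apply: val_inj; rewrite /= val_monom. Qed.

Lemma monomD u v : in_cone D u -> in_cone D v -> monom (u + v)%MM = monom u * monom v.
Proof.
move=> uC vC; apply/esym/monom_eq; first exact: in_coneD.
by rewrite mpolyXD -!val_monom.
Qed.

Lemma monom_neq0 u : in_cone D u -> monom u != 0.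
Proof.
move=> uC; apply/eqP => /(congr1 (@toric_val _ _ _)); rewrite val_monom //.
move=> /(congr1 (fun p : P => p@_u)); rewrite mcoeffX eqxx mcoeff0.
by apply/eqP; rewrite oner_eq0.
Qed.

Lemma frac_monom_neq0 u : in_cone D u -> (monom u)%:L != 0.
Proof. by move=> uC; rewrite tofrac_eq0 monom_neq0. Qed.

Lemma in_cone_tvar k : in_cone D (U_(tv) *+ k)%MM.
Proof.
by move=> C _; rewrite off_sum_tvarMn.
Qed.

Lemma mvc_exists : exists C, mvc C.
Proof.
have [|C Cmin _] := @stable_cover _ D set0; last by exists C.
by move=> i j; rewrite inE.
Qed.

(** [c] is the class of a fractional ideal whose inverse [R : I] consists of the
    [x] that the monomials with exponents in [S] multiply into [R].  The ideal
    is recorded through its inverse because products of ideals and divisorial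
    closures are both visible there. *)
Definition monomial_class (c : Cl R) (S : 'X_{1..n.+1} -> Prop) : Prop :=
  exists I : fracideal R, c = \pi_(Cl R) I /\
    forall x, fi_dual I x <-> forall m, S m -> fi_one (x * (monom m)%:L).

Lemma Cl_of_monomials (A : set R) (S : 'X_{1..n.+1} -> Prop) m0 :
    S m0 -> (forall m, S m -> in_cone D m) ->
    A = ideal_gen (fun p : R => exists2 m, S m & toric_val p = 'X_[m]) ->
  monomial_class (Cl_of A) S.
Proof.
move=> Sm0 SC ->.
set G : set R := fun p => _.
have SX m : S m -> G (monom m).
  by move=> Sm; exists m => //; apply: val_monom; apply: SC.
have [I [IE Idual]] := @Cl_of_ideal_gen R G _ (SX _ Sm0) (monom_neq0 (SC _ Sm0)).
exists I; split=> // x; rewrite Idual; split=> [H m /SX|H p [m Sm pm]].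
  exact: H.
by rewrite (monom_eq (SC _ Sm) pm); apply: H.
Qed.

(** [c] is the class of [\sum_C d C *: P_C], witnessed by a set [S] of monomials
    whose valuations at each [C] have minimum [d C].  All the
    conditions are additive in [c] and [d].  The power of [t] in [S] serves in
    [divisor_class_dual] to write an element of [R : I] with a monomial
    denominator that involves [t] only. *)
Definition divisor_class (c : Cl R) d : Prop :=
  exists2 S : 'X_{1..n.+1} -> Prop, monomial_class c S &
  [/\ forall m, S m -> divisor_ge D d m,
      forall C, mvc C -> exists2 m, S m & (d C + off_sum C m)%N = m tv &
      exists k, S (U_(tv) *+ k)%MM].

Lemma divisor_class_ext c d d' : (forall C, mvc C -> d C = d' C) ->
  divisor_class c d -> divisor_class c d'.
Proof.
move=> dd [S cS [Sge Seq Sk]]; exists S => //; split=> //.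
  by move=> m /Sge mge C Cmin; rewrite -dd // mge.
by move=> C Cmin; rewrite -dd //; apply: Seq.
Qed.

Lemma divisor_class0 : divisor_class 0 (fun=> 0%N).
Proof.
have C0 : in_cone D 0%MM by apply: in_cone0.
have X0 : monom 0%MM = 1 by apply/esym/monom_eq => //; rewrite mpolyX0.
exists (fun m => m = 0%MM); last first.
  split=> [_ ->|C _|] //; last by exists 0%N.
  by exists 0%MM => //; rewrite off_sum0 mnm0E.
exists (fracideal_one R); split; first by rewrite /GRing.zero /= !piE.
move=> x; split=> [H _ ->|/(_ _ erefl)].
  by apply: H; exists (monom 0%MM).
rewrite X0 rmorph1 mulr1 => -[r ->] _ [s ->].
by exists (r * s); rewrite rmorphM.
Qed.

Lemma divisor_classD c d c' d' : divisor_class c d -> divisor_class c' d' ->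
  divisor_class (c + c') (fun C => d C + d' C)%N.
Proof.
move=> [S [I [-> IS]] [Sge Seq [k Sk]]] [S' [I' [-> IS']] [Sge' Seq' [k' Sk']]].
exists (fun m => exists v v', [/\ S v, S' v' & m = (v + v')%MM]); last first.
  split=> [_ [v [v' [Sv Sv' ->]]]|C Cmin|].
  - by apply: divisor_geD; [apply: Sge | apply: Sge'].
  - have [[v Sv vC] [v' Sv' vC']] := (Seq C Cmin, Seq' C Cmin).
    exists (v + v')%MM; first by exists v, v'.
    by rewrite off_sumD mnmDE -vC -vC' addnACA.
  - exists (k + k')%N, (U_(tv) *+ k)%MM, (U_(tv) *+ k')%MM.
    by split=> //; apply/mnmP => j; rewrite mnmDE !mulmnE mulnDr.
exists (fracideal_mul I I'); split; first by rewrite /GRing.add /= !piE.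
have SC m : S m -> in_cone D m by move=> /Sge /divisor_ge_cone.
have SC' m : S' m -> in_cone D m by move=> /Sge' /divisor_ge_cone.
move=> x; rewrite /= fi_dual_mul; split.
  move=> H _ [v [v' [Sv Sv' ->]]]; rewrite (monomD (SC _ Sv) (SC' _ Sv')) tofracM mulrA.
  have /IS' : fi_dual I' (x * (monom v)%:L).
    by move=> y I'y; rewrite mulrAC; have /IS := H y I'y; apply.
  exact.
move=> H y I'y; apply/IS => v Sv; rewrite mulrAC.
have : fi_dual I' (x * (monom v)%:L); last by apply.
apply/IS' => v' Sv'; rewrite -mulrA -tofracM -(monomD (SC _ Sv) (SC' _ Sv')).
by apply: H; exists v, v'.
Qed.

Lemma divisor_classMn c d k : divisor_class c d ->
  divisor_class (c *+ k) (fun C => d C * k)%N.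
Proof.
move=> cd; elim: k => [|k IHk].
  by rewrite mulr0n; apply: divisor_class_ext divisor_class0 => C; rewrite muln0.
rewrite mulrSr; apply: divisor_class_ext (divisor_classD IHk cd) => C _.
by rewrite mulnS addnC.
Qed.

Lemma divisor_class_sum (c : {set 'I_n} -> Cl R) (d : {set 'I_n} -> {set 'I_n} -> nat) :
  (forall C, mvc C -> divisor_class (c C) (d C)) ->
  divisor_class (\sum_(C | mvc C) c C) (fun C0 => \sum_(C | mvc C) d C C0)%N.
Proof.
move=> cd; elim: (index_enum _) => [|C s IHs].
  by rewrite big_nil; apply: divisor_class_ext divisor_class0 => C; rewrite big_nil.
rewrite big_cons; case: ifP => Cmin.
  apply: divisor_class_ext (divisor_classD (cd _ Cmin) IHs) => C0 _.
  by rewrite big_cons Cmin.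
by apply: divisor_class_ext IHs => C0 _; rewrite big_cons Cmin.
Qed.

(** [t] has valuation 1 at [P_C], and for a minimal vertex cover [C0] other than
    [C] a vertex [i] of [C] outside [C0] gives the element [x_i t] of [P_C], of
    valuation 0 at [P_C0]. *)
Lemma divisor_class_cover C : mvc C ->
  divisor_class (Cl_of (cover_ideal K D C)) (fun C0 => C0 == C).
Proof.
move=> Cmin.
have t0 : toric_mnm set0 = (U_(tv) *+ 1)%MM.
  by rewrite /toric_mnm big_set0 mulm1n add0m.
exists (fun m => exists F, [/\ F \in D, F \subset C & m = toric_mnm F]).
  apply: (@Cl_of_monomials _ _ (toric_mnm set0)).
  - by exists set0; rewrite face0 ?finset.sub0set.
  - by move=> _ [F [FD _ ->]]; apply: in_cone_toric.
  - congr ideal_gen; apply/seteqP; split=> p.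
      by move=> [F [FD FC pF]]; exists (toric_mnm F) => //; exists F.
    by move=> [_ [F [FD FC ->]] pF]; exists F.
split=> [_ [F [FD FC ->]] C0 C0min|C0 C0min|].
- have [->|_] := eqVneq C0 C; last exact: (in_cone_toric hD FD C0min).
  rewrite off_sum_toric toric_mnm_tvar.
  by move: FC; rewrite -finset.setD_eq0 => /eqP ->; rewrite cards0.
- have [->|C0C] := eqVneq C0 C.
    exists (toric_mnm set0); first by exists set0; rewrite face0 ?finset.sub0set.
    by rewrite off_sum_toric toric_mnm_tvar finset.set0D cards0.
  have /subsetPn[i iC iC0] : ~~ (C \subset C0).
    apply: contra C0C => CC0; have /minsetP[_ C0m] := C0min.
    by rewrite -(C0m C) // (minsetp Cmin).
  exists (toric_mnm [set i]); first by exists [set i]; rewrite face1 ?sub1set.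
  rewrite off_sum_toric toric_mnm_tvar (_ : _ :\: _ = [set i]) ?cards1 //.
  by apply/finset.setDidPl; rewrite disjoints1.
- by exists 1%N, set0; rewrite face0 ?finset.sub0set.
Qed.

(** The ideal generated by [S] and the divisorial ideal of [d] have the same
    inverse.  If [x] multiplies [S] into [R] then [x = g / t^k] with [g] in [R].
    Multiplying by an [m] in [S] whose valuation at [C] is exactly [d C] shows
    that every monomial of [g / t^k] has valuation at least [- d C] at [C]; so
    its product with any monomial [b] in [divisor_ge d] has nonnegative
    valuations. *)
Lemma divisor_class_dual c d : divisor_class c d -> monomial_class c (divisor_ge D d).
Proof.
move=> [S [I [-> IS]] [Sge Seq [k Sk]]]; exists I; split=> // x; split; last first.
  by move=> H; apply/IS => m /Sge; apply: H.
move=> /IS xS b bge; have bC := divisor_ge_cone bge; have kC := in_cone_tvar k.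
have [g gE] := xS _ Sk.
have gsupp w C : w \in msupp (toric_val g) -> mvc C ->
    (off_sum C w + k <= w tv + d C)%N.
  move=> wg Cmin; have [m Sm mC] := Seq C Cmin; have [r rE] := xS m Sm.
  have mcone := divisor_ge_cone (Sge _ Sm).
  have gr : g * monom m = r * monom (U_(tv) *+ k)%MM.
    by apply/eqP; rewrite -tofrac_eq !tofracM -gE -rE mulrAC.
  have : (w + m)%MM \in msupp (toric_val g * 'X_[m]).
    by rewrite (perm_mem (msuppMX _ _)); apply/mapP; exists w; rewrite // addmC.
  rewrite -(val_monom mcone) -[_ * _]/(toric_val (g * _)) gr.
  rewrite -[toric_val _]/(toric_val r * toric_val _) val_monom //.
  rewrite (perm_mem (msuppMX _ _)) => /mapP[w' w'r ww'].
  have := (iffLR (toric_predP hD hqf _) (toric_valP r)) _ w'r C Cmin.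
  have := congr1 (off_sum C) ww'; have := congr1 (fun u : 'X_{1..n.+1} => u tv) ww'.
  by rewrite /= !off_sumD !mnmDE tvarMn_tvar off_sum_tvarMn; lia.
have [|r rT rE] := @toric_divX n D hD hqf K (toric_val (g * monom b)) (U_(tv) *+ k)%MM.
  move=> u; rewrite -[toric_val _]/(toric_val g * toric_val _) val_monom //.
  rewrite (perm_mem (msuppMX _ _)) => /mapP[w wg ->].
  have wb C : mvc C -> (off_sum C (b + w)%MM + k <= (b + w)%MM tv)%N.
    move=> Cmin; have := gsupp w C wg Cmin; have := bge C Cmin.
    rewrite off_sumD mnmDE; lia.
  have kle : (U_(tv) *+ k <= b + w)%MM.
    apply/mnm_lepP => j; have [->|[i ->]] := var_cases j; last by rewrite tvarMn_xvar.
    by rewrite tvarMn_tvar; have [C Cmin] := mvc_exists; have := wb C Cmin; lia.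
  exists (b + w - U_(tv) *+ k)%MM; last by rewrite [RHS]addmC submK.
  have bwE := submK kle; move: (b + w - _)%MM bwE => q bwE C Cmin.
  have := wb C Cmin; by rewrite -bwE off_sumD mnmDE tvarMn_tvar; lia.
exists (ToricRing rT); apply: (mulIf (frac_monom_neq0 kC)).
rewrite mulrAC gE -!tofracM; congr (_%:L); apply: val_inj.
by apply: etrans rE _; rewrite mulrC -(val_monom kC).
Qed.

Variable RR : realType.

Lemma interior_ge u : interior_mnm D u -> in_cone D u.
Proof. by case=> _ /divisor_ge_cone. Qed.

Lemma interior_cone u v : interior_mnm D u -> in_cone D v -> interior_mnm D (u + v)%MM.
Proof.
move=> [u0 uD] vC; split=> [i|]; first by rewrite mnmDE ltn_addr.
by apply: (divisor_geD uD vC).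
Qed.

Lemma canonical_ideal_gen : canonical_ideal K D RR =
  ideal_gen (fun p : R => exists2 u, interior_mnm D u & toric_val p = 'X_[u]).
Proof.
apply/seteqP; split=> p.
  move=> pI; have pT u : u \in msupp (toric_val p) -> interior_mnm D u.
    by move=> /pI /relative_interior_mnm; apply.
  have aT u : (((toric_val p)@_u)%:MP : P) \in toric_pred K D.
    by apply/asboolP; exists ((toric_val p)@_u)%:MP; rewrite comp_mpolyC.
  pose s := in_tuple (msupp (toric_val p)).
  exists (size (msupp (toric_val p))), (fun i => ToricRing (aT (tnth s i))),
    (fun i => monom (tnth s i)).
  have sT i : interior_mnm D (tnth s i) by apply: pT; apply: mem_tnth.
  split=> [i|].
    by exists (tnth s i) => //; apply: val_monom; apply: interior_ge.
  apply: val_inj; rewrite [LHS]mpolyE rmorph_sum (big_tnth _ _ (msupp _)) /=.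
  apply: eq_bigr => i _.
  by rewrite -mul_mpolyC val_monom //; apply: interior_ge.
move=> [k [a [s [sI ->]]]] u; rewrite -[toric_val _]/(\val _) rmorph_sum.
move=> /msupp_sum_le /flattenP[_ /mapP[i _ ->]].
have [v vI sv] := sI i.
rewrite -[X in msupp X]/(toric_val (a i) * toric_val (s i)) sv.
move=> /msuppM_le /allpairsP[[w w']] /= [wa]; rewrite msuppX inE => /eqP -> ->.
apply/relative_interior_mnm => //; rewrite addmC; apply: interior_cone => //.
exact: (iffLR (toric_predP hD hqf _) (toric_valP (a i))).
Qed.

(** Multiplication by the Laurent monomial of exponent [v - v'] is an isomorphism
    of divisorial ideals as soon as it matches their monomials. *)
Lemma monomial_class_shift c c' (S S' : 'X_{1..n.+1} -> Prop) v v' :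
    monomial_class c S -> monomial_class c' S' ->
    in_cone D v -> in_cone D v' ->
    (forall m, S m -> in_cone D m) -> (forall m, S' m -> in_cone D m) ->
    (forall m, S m -> exists2 m', S' m' & (m + v' = m' + v)%MM) ->
    (forall m', S' m' -> exists2 m, S m & (m + v' = m' + v)%MM) ->
  c = c'.
Proof.
move=> [I [-> IS]] [I' [-> IS']] vC vC' SC SC' SS' S'S.
pose f := (monom v)%:L / (monom v')%:L.
have fE m m' : in_cone D m -> in_cone D m' -> (m + v' = m' + v)%MM ->
    f * (monom m')%:L = (monom m)%:L.
  move=> mC mC' mm'; apply: (mulIf (frac_monom_neq0 vC')).
  by rewrite mulrAC divfK ?frac_monom_neq0 // -!tofracM -!monomD // mm' addmC.
apply/eqmodP/class_equivP; exists f.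
  by rewrite mulf_neq0 ?invr_eq0 ?frac_monom_neq0.
move=> x; rewrite IS IS'; split=> H.
  move=> m' Sm'; have [m Sm mm'] := S'S m' Sm'.
  by rewrite -mulrA (fE m m' (SC _ Sm) (SC' _ Sm') mm'); apply: H.
move=> m Sm; have [m' Sm' mm'] := SS' m Sm.
by rewrite -(fE m m' (SC _ Sm) (SC' _ Sm') mm') mulrA; apply: H.
Qed.

Lemma canonical_class :
  monomial_class (Cl_of (canonical_ideal K D RR)) (interior_mnm D).
Proof.
exact: (Cl_of_monomials (interior_center D) interior_ge canonical_ideal_gen).
Qed.

(** Dividing by [x_1 ... x_n t], whose valuation at [P_C] is [1 - #|~: C|], turns
    the positivity conditions at the variables into nonnegativity, and the
    conditions [>= 1] at the [P_C] into [>= #|~: C|]. *)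
Lemma interior_translate u :
  interior_mnm D u <->
  exists2 b, divisor_ge D (fun C => #|~: C|) b & u = (toric_mnm [set: 'I_n] + b)%MM.
Proof.
have offT C : off_sum C (toric_mnm [set: 'I_n]) = #|~: C|.
  by rewrite off_sum_toric finset.setTD.
split=> [[u0 uD]|[b bD ->]]; last first.
  split=> [i|C Cmin]; first by rewrite mnmDE toric_mnm_xvar inE.
  by rewrite off_sumD offT mnmDE toric_mnm_tvar leq_add2l bD.
have Tle : (toric_mnm [set: 'I_n] <= u)%MM.
  apply/mnm_lepP => j; have [->|[i ->]] := var_cases j; last first.
    by rewrite toric_mnm_xvar inE u0.
  rewrite toric_mnm_tvar; have [C Cmin] := mvc_exists.
  exact: leq_trans (uD C Cmin).
exists (u - toric_mnm [set: 'I_n])%MM; last by rewrite [RHS]addmC submK.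
have uE := submK Tle; move: (u - _)%MM uE => q uE C Cmin.
have := uD C Cmin; rewrite -uE off_sumD mnmDE offT toric_mnm_tvar; lia.
Qed.

(** The monomial [x_1 ... x_n t] need not be in the toric ring; it is written
    as the quotient of the monomial of exponent [center] by [t^n]. *)
Lemma canonical_divisor_class c :
  divisor_class c (fun C => #|~: C|) -> Cl_of (canonical_ideal K D RR) = c.
Proof.
move=> /divisor_class_dual cd.
apply: (monomial_class_shift (v := center n) (v' := (U_(tv) *+ n)%MM) canonical_class cd).
- by have [_ /divisor_ge_cone] := interior_center D.
- exact: in_cone_tvar.
- exact: interior_ge.
- by move=> m /divisor_ge_cone.
- move=> m /interior_translate[b bD ->]; exists b => //.
  by rewrite /center addmA [(b + _)%MM]addmC.
- move=> b bD; exists (toric_mnm [set: 'I_n] + b)%MM.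
    by apply/interior_translate; exists b.
  by rewrite /center addmA [(b + _)%MM]addmC.
Qed.

Lemma canonical_class_sum :
  Cl_of (canonical_ideal K D RR) =
  \sum_(C : {set 'I_n} | mvc C) Cl_of (cover_ideal K D C) *+ (n - #|C|).
Proof.
apply: canonical_divisor_class.
have := divisor_class_sum (fun C Cmin =>
  divisor_classMn (n - #|C|) (divisor_class_cover Cmin)).
apply: divisor_class_ext => C Cmin.
rewrite (bigD1 C) //= eqxx mul1n big1 ?addn0 => [|C' /andP[_ /negbTE CC']].
  by rewrite [RHS]cardsCs finset.setCK card_ord.
by rewrite eq_sym CC'.
Qed.

(** * The initial degree of the canonical ideal *)

Lemma nonzero_degreeP i : nonzero_degree (canonical_ideal K D RR) i <->
  exists2 u, interior_mnm D u & u tv = i.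
Proof.
split=> [[p [pI pi] p0]|[u uI ui]].
  have : msupp (toric_val p) != [::].
    by rewrite msupp_eq0; apply: contraNneq p0 => p0; apply/eqP/val_inj.
  case E : (msupp _) => [//|u s] _; have up : u \in msupp (toric_val p).
    by rewrite E mem_head.
  by exists u; [apply/relative_interior_mnm => //; apply: pI | apply: pi].
have uC := interior_ge uI.
exists (monom u); last exact: monom_neq0.
split=> v; rewrite val_monom // msuppX inE => /eqP -> //.
exact/relative_interior_mnm.
Qed.

Lemma face_cover_self : face_cover D D.
Proof.
apply/andP; split=> //; apply/eqP/setP => i; rewrite inE; apply/bigcupP.
by exists [set i]; rewrite ?face1 ?inE.
Qed.

(** Dividing an interior monomial by [t] leaves a product of [u tv - 1] generators
    [x_F t]; their faces cover every vertex, since each [x_i] occurs. *)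
Lemma face_cover_number_interior u :
  interior_mnm D u -> (face_cover_number D < u tv)%N.
Proof.
move=> [u0 uD].
have [C Cmin] := mvc_exists; have ut := uD C Cmin.
have tle : (U_(tv) <= u)%MM.
  apply/mnm_lepP => j; rewrite mnm1E; have [<-|//] := eqVneq.
  exact: leq_trans ut.
have uE := submK tle; move: (u - _)%MM uE => q uE.
have qx i : q (xvar i) = u (xvar i).
  by rewrite -uE mnmDE mnm1E tvar_xvar addn0.
have qt : u tv = (q tv).+1 by rewrite -uE mnmDE mnm1E eqxx addn1.
have [|c [cD cx ct]] := @in_cone_decomposition _ _ hD hqf q.
  move=> C' C'min; have := uD C' C'min; rewrite qt -uE off_sumD; lia.
pose S := [set F | c F != 0%N].
have Scov : face_cover D S.
  apply/andP; split.
    by apply/subsetP => F; rewrite inE; apply: contraNT => /cD ->.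
  apply/eqP/setP => i; rewrite inE; apply/bigcupP.
  have : (\sum_(F : {set 'I_n} | i \in F) c F != 0)%N by rewrite cx qx -lt0n.
  rewrite sum_nat_eq0 negb_forall => /existsP[F]; rewrite negb_imply => /andP[iF cF].
  by exists F; rewrite ?inE.
rewrite qt ltnS -ct; apply: leq_trans (_ : #|S| <= _)%N.
  rewrite /face_cover_number; case: arg_minnP => [|S' _ S'min].
    exact: face_cover_self.
  exact: S'min.
rewrite -sum1_card (bigID (mem S) xpredT) /=; apply: leq_trans (leq_addr _ _).
by apply: leq_sum => F; rewrite inE lt0n.
Qed.

(** Conversely the product of the [x_F t] over a face cover, times [t], is an
    interior monomial. *)
Lemma face_cover_number_attained :
  exists2 u, interior_mnm D u & u tv = (face_cover_number D + 1)%N.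
Proof.
rewrite /face_cover_number; case: arg_minnP => [|S /andP[SD /eqP Scov] _].
  exact: face_cover_self.
exists (\sum_(F in S) toric_mnm F + U_(tv))%MM; last first.
  rewrite mnmDE mnm1E eqxx mnm_sumE -sum1_card; congr (_ + _)%N.
  by apply: eq_bigr => F _; rewrite toric_mnm_tvar.
have SC : in_cone D (\sum_(F in S) toric_mnm F)%MM.
  apply: (big_ind (in_cone D)); first exact: in_cone0.
    exact: in_coneD.
  by move=> F FS; apply: in_cone_toric => //; apply: (subsetP SD).
split=> [i|C Cmin].
  have : i \in cover S by rewrite Scov inE.
  by case/bigcupP => F FS iF; rewrite mnmDE mnm_sumE (bigD1 F) //= toric_mnm_xvar iF.
rewrite off_sumD mnmDE mnm1E eqxx [leqRHS]addnC leq_add2l.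
rewrite [X in (_ + X)%N](_ : _ = 0%N) ?addn0; first exact: SC.
by rewrite /off_sum big1 // => i _; rewrite mnm1E tvar_xvar.
Qed.

Lemma a_invariant_face_cover :
  a_invariant K D RR = - (face_cover_number D + 1)%N%:Z.
Proof.
rewrite /a_invariant; congr (- _%:Z).
have [u uI ut] := face_cover_number_attained.
apply: xget_unique.
  split=> [|j /nonzero_degreeP[v vI <-]]; first by apply/nonzero_degreeP; exists u.
  by rewrite addn1 face_cover_number_interior.
move=> i [/nonzero_degreeP[v vI <-] vmin].
apply/eqP; rewrite eqn_leq; apply/andP; split.
  by apply: vmin; apply/nonzero_degreeP; exists u.
by rewrite addn1 face_cover_number_interior.
Qed.

End ToricClass.

Theorem corollary2p3 (RR : realType) (K : fieldType) (n : nat)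
    (D : {set {set 'I_n}})
    (hD : simplicial_complex D) (hqf : quasi_forest D) :
  (Cl_of (canonical_ideal K D RR) =
     \sum_(C : {set 'I_n} | min_vertex_cover (skeleton D) C)
        Cl_of (cover_ideal K D C) *+ (n - #|C|)
     :> Cl (toric_ring K D))
  /\
  a_invariant K D RR = - (face_cover_number D + 1)%N%:Z.
Proof. by split; [apply: canonical_class_sum | apply: a_invariant_face_cover]. Qed.
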